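(* For every real $x\in(-3,c)$, $$\sum_{k=1}^\infty\frac{x^{3k}}{k^2(x-1)^k\binom{3k}{k}}=\frac23\,q(x)^2-\frac12\log^2(1-x).$$
   Context: The constant $c$ is $c=\frac32\left[(1+\sqrt2)^{1/3}-(1+\sqrt2)^{-1/3}\right]=0.8941\cdots$. For $x\in(-3,1)$ the function $q$ is $$q(x)=\arg\frac{1+x-i\sqrt{(1-x)(3+x)}}{1-x-i\sqrt{(1-x)(3+x)}}=\begin{cases}\tan^{-1}\!\Big(\frac{x}{x+2}\sqrt{\frac{3+x}{1-x}}\Big)&\text{if }-2<x<1,\\ -\frac{\pi}{2}&\text{if }x=-2,\\ \tan^{-1}\!\Big(\frac{x}{x+2}\sqrt{\frac{3+x}{1-x}}\Big)-\pi&\text{if }-3<x<-2,\end{cases}$$ where $\tan^{-1}$ is the inverse tangent function with values in $(-\pi/2,\pi/2)$. One has $|x^3/(x-1)|<27/4$ for $x\in(-3,c)$. Here $\log^2 y$ means $(\log y)^2$. *)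

(* Defs.v *)
From Stdlib Require Import Reals Lra.
From Coquelicot Require Import Coquelicot.
Open Scope R_scope.

(* [Rpower y a] is the real power [y ^ a], for [y > 0]. *)
Definition c : R :=
  3 / 2 * (Rpower (1 + sqrt 2) (1 / 3) - Rpower (1 + sqrt 2) (- (1 / 3))).

(* Principal argument, with values in (-PI, PI]; the value at 0 is junk.
   [Arg_polar] and [Arg_unique] characterize it. *)
Definition Arg (z : C) : R :=
  if Rle_dec 0 (Im z) then acos (Re z / Cmod z) else - acos (Re z / Cmod z).

Definition q (x : R) : R :=
  let w := sqrt ((1 - x) * (3 + x)) in
  Arg (((RtoC 1 + RtoC x) - Ci * RtoC w) / ((RtoC 1 - RtoC x) - Ci * RtoC w))%C.

Lemma Arg_unique (r t : R) :
  0 < r -> - PI < t <= PI -> Arg (r * cos t, r * sin t) = t.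
Proof.
intros Hr Ht.
assert (Hm : Cmod (r * cos t, r * sin t) = r).
{ unfold Cmod; simpl fst; simpl snd.
  replace ((r * cos t) ^ 2 + (r * sin t) ^ 2) with (r * r).
  - now apply sqrt_square, Rlt_le.
  - generalize (sin2_cos2 t); unfold Rsqr; intros H; nra. }
unfold Arg; rewrite Hm; simpl.
replace (r * cos t / r) with (cos t) by (field; lra).
destruct (Rle_lt_dec 0 t) as [H0 | H0].
- destruct Rle_dec as [_ | H]; [now apply acos_cos|].
  exfalso; apply H, Rmult_le_pos; [lra | now apply sin_ge_0].
- assert (Hs : sin (- t) > 0) by (apply sin_gt_0; lra).
  rewrite sin_neg in Hs.
  destruct Rle_dec as [H | _]; [exfalso; nra|].
  rewrite <- (cos_neg t), acos_cos; lra.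
Qed.

Lemma Arg_polar (z : C) : z <> 0%C ->
  - PI < Arg z <= PI /\ z = (Cmod z * cos (Arg z), Cmod z * sin (Arg z)).
Proof.
intros Hz.
assert (Hr := proj1 (Cmod_gt_0 z) Hz).
assert (H2 := Cmod2_alt z).
set (r := Cmod z) in *; set (u := Re z / r).
assert (Hu : Re z = r * u) by (unfold u; field; lra).
assert (Hi : Im z ^ 2 = r ^ 2 * (1 - u²)) by (rewrite Hu in H2; unfold Rsqr; nra).
assert (Hu1 : 0 <= 1 - u²)
  by (apply (Rmult_le_reg_l (r ^ 2)); [now apply pow_lt|];
      rewrite Rmult_0_r, <- Hi; apply pow2_ge_0).
assert (Hb : -1 <= u <= 1) by (unfold Rsqr in Hu1; nra).
assert (Hs : Rabs (Im z) = r * sqrt (1 - u²)).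
{ rewrite <- sqrt_Rsqr_abs, Rsqr_pow2, Hi.
  rewrite sqrt_mult, sqrt_pow2; [reflexivity | lra | apply pow2_ge_0 | exact Hu1]. }
assert (Ha := acos_bound u).
assert (Hc := cos_acos u Hb); assert (Hsa := sin_acos u Hb).
destruct z as [a b]; unfold Arg; fold r u; simpl in *.
destruct Rle_dec as [H | H].
- rewrite Rabs_pos_eq in Hs by lra.
  split; [generalize PI_RGT_0; lra|].
  rewrite Hc, Hsa; f_equal; lra.
- rewrite Rabs_left in Hs by lra.
  assert (acos u <> PI).
  { intros E; rewrite E, sin_PI in Hsa; rewrite <- Hsa in Hs; lra. }
  split; [generalize PI_RGT_0; lra|].
  rewrite cos_neg, sin_neg, Hc, Hsa; f_equal; lra.
Qed.

Lemma Arg_pos (a b : R) : 0 < a -> Arg (a, b) = atan (b / a).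
Proof.
intros Ha.
assert (Hq : 0 < sqrt (1 + (b / a)²)).
{ apply sqrt_lt_R0; generalize (Rle_0_sqr (b / a)); lra. }
rewrite <- (Arg_unique (a * sqrt (1 + (b / a)²)) (atan (b / a))).
- rewrite cos_atan, sin_atan; f_equal; f_equal; field; repeat split; lra.
- now apply Rmult_lt_0_compat.
- generalize (atan_bound (b / a)) PI_RGT_0; lra.
Qed.

Lemma Arg_negneg (a b : R) : a < 0 -> b < 0 -> Arg (a, b) = atan (b / a) - PI.
Proof.
intros Ha Hb.
assert (Hq : 0 < sqrt (1 + (b / a)²)).
{ apply sqrt_lt_R0; generalize (Rle_0_sqr (b / a)); lra. }
assert (Hy : 0 < b / a).
{ replace (b / a) with ((- b) / (- a)) by (field; lra).
  apply Rdiv_lt_0_compat; lra. }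
rewrite <- (Arg_unique (- a * sqrt (1 + (b / a)²)) (atan (b / a) - PI)).
- rewrite cos_minus, sin_minus, cos_PI, sin_PI, cos_atan, sin_atan.
  f_equal; f_equal; field; repeat split; lra.
- apply Rmult_lt_0_compat; lra.
- assert (H := atan_increasing 0 (b / a) Hy); rewrite atan_0 in H.
  generalize (atan_bound (b / a)) PI_RGT_0; lra.
Qed.

Lemma q_rect (x : R) : -3 < x < 1 ->
  q x = Arg ((2 + x) / 2, x / 2 * sqrt ((3 + x) / (1 - x))).
Proof.
intros Hx; unfold q; cbv zeta.
set (s := sqrt ((3 + x) / (1 - x))).
assert (Hw : sqrt ((1 - x) * (3 + x)) = (1 - x) * s).
{ replace ((1 - x) * (3 + x)) with ((1 - x) ^ 2 * ((3 + x) / (1 - x)))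
    by (field; lra).
  rewrite sqrt_mult, sqrt_pow2; [reflexivity | lra | apply pow2_ge_0 |].
  apply Rlt_le, Rdiv_lt_0_compat; lra. }
assert (Hs : s ^ 2 = (3 + x) / (1 - x)).
{ apply pow2_sqrt, Rlt_le, Rdiv_lt_0_compat; lra. }
rewrite Hw; f_equal.
assert (Hd : (1 - x) ^ 2 + ((1 - x) * s) ^ 2 = 4 * (1 - x)).
{ rewrite Rpow_mult_distr, Hs; field; lra. }
unfold Cdiv, Cmult, Cinv, Cminus, Cplus, Copp, RtoC, Ci; cbn [fst snd].
match goal with |- context [?u / (?a ^ 2 + ?b ^ 2)] =>
  replace (a ^ 2 + b ^ 2) with (4 * (1 - x)) by (rewrite <- Hd; ring) end.
f_equal; [|field; lra].
transitivity (((1 + x) * (1 - x) + (1 - x) ^ 2 * s ^ 2) / (4 * (1 - x)));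
  [|rewrite Hs]; field; lra.
Qed.

Lemma q_cases (x : R) : -3 < x < 1 ->
  (-2 < x -> q x = atan (x / (x + 2) * sqrt ((3 + x) / (1 - x)))) /\
  (x = -2 -> q x = - (PI / 2)) /\
  (x < -2 -> q x = atan (x / (x + 2) * sqrt ((3 + x) / (1 - x))) - PI).
Proof.
intros Hx; rewrite (q_rect x Hx).
assert (Hs : 0 < sqrt ((3 + x) / (1 - x))).
{ apply sqrt_lt_R0, Rdiv_lt_0_compat; lra. }
set (s := sqrt _) in *.
split; [|split]; intros H.
- rewrite Arg_pos by lra; f_equal; field; lra.
  rewrite <- (Arg_unique s (- (PI / 2))).
  + rewrite cos_neg, sin_neg, cos_PI2, sin_PI2, H; f_equal; f_equal; field.
  + exact Hs.
  + generalize PI_RGT_0; lra.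
- rewrite Arg_negneg by nra; f_equal; f_equal; field; lra.
Qed.

(* Main.v *)
Require Import Defs.
From Stdlib Require Import Reals Lra Lia.
From Coquelicot Require Import Coquelicot.
Open Scope R_scope.

(** The proof goes through a differential equation. Put [y = x ^ 3 / (x - 1)] and
let [F] be the power series with coefficients [1 / (k ^ 2 * C (3k) k)], whose
radius of convergence is at least [27 / 4]. The two-term recurrence of the
binomials [C (3k) k] says that [F'] solves a linear differential equation of
order two with polynomial coefficients ([F_ode]). The substitution is made
for this equation: the discriminant [27 - 4 y] becomes
[(2 x - 3) ^ 2 * (x + 3) / (1 - x)], and in the variable [x] the function
[f x = F (y x)] satisfies a third-order equation whose homogeneous solutions
are spanned by [1], [ln (1 - x)] and [q]. Indeed [q] is, up to a constant, a multiple of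
[acos ((1 + x) / 2)] ([q_acos]), so that [q' = 3 / (2 w)] with
[w = sqrt ((1 - x) (3 + x))].

Knowing these solutions, one lowers the order three times. The homogeneous
solutions of the equation for [f'] are [1 / (1 - x)] and [1 / w]; hence
[g = (1 - x) f'] has homogeneous solutions [1] and [s = (1 - x) / w], and
[g' / s'] is determined up to a constant, its derivative being an elementary
function. Integrating gives [first_integral], then [g_closed_form], then
[F_closed_form]. Each step says that a function which vanishes at [0] has
derivative zero on [(-3, c)]. In the variable [x] no singularity occurs
inside this interval: the point [y = 0], singular for [F_ode],
is harmless in the combination that is integrated.

The endpoint [c] is the real root of [4 x ^ 3 + 27 x - 27] ([c_cubic]), where
[y = - 27 / 4], and [-3] is where [y = 27 / 4]; between them [y] stays inside
the disk of convergence. *)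

(** After [auto_derive], evaluates the [Derive] that [H : is_derive f u l] computes. *)
Ltac derive_with H :=
  match type of H with is_derive ?f ?u ?l =>
    change (Derive (fun t => f t) u) with (Derive f u);
    rewrite ?(is_derive_unique f u l H) end.

(** Lets [ring] and [field] see that an equation in a Coquelicot structure is over [R]. *)
Ltac real_eq := match goal with |- ?a = ?b => change (@eq R a b) end.

(** * The power series and its differential equation *)

(** With the convention [/ 0 = 0] the term of index [0] vanishes, as it should
for a series that starts at [1]. *)
Definition coef (k : nat) : R := / (INR k ^ 2 * Binomial.C (3 * k) k).

Lemma binomial_3k_k_pos (k : nat) : 0 < Binomial.C (3 * k) k.
Proof.
unfold Binomial.C; apply Rdiv_lt_0_compat; [|apply Rmult_lt_0_compat];
  apply INR_fact_lt_0.
Qed.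

Lemma binomial_3k_k_S (k : nat) :
  Binomial.C (3 * S k) (S k) * (2 * (INR k + 1) * (2 * INR k + 1)) =
  3 * (3 * INR k + 1) * (3 * INR k + 2) * Binomial.C (3 * k) k.
Proof.
unfold Binomial.C.
replace (3 * S k)%nat with (S (S (S (3 * k)))) by lia.
replace (S (S (S (3 * k))) - S k)%nat with (S (S (2 * k))) by lia.
replace (3 * k - k)%nat with (2 * k)%nat by lia.
rewrite !fact_simpl, !mult_INR, !S_INR, !mult_INR.
replace (INR 3) with 3 by (simpl; ring).
replace (INR 2) with 2 by (simpl; ring).
generalize (INR_fact_lt_0 k) (INR_fact_lt_0 (2 * k)) (pos_INR k); intros.
field; repeat split; lra.
Qed.

Lemma coef_S_pos (k : nat) : 0 < coef (S k).
Proof.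
apply Rinv_0_lt_compat, Rmult_lt_0_compat; [|apply binomial_3k_k_pos].
apply pow_lt, lt_0_INR; lia.
Qed.

Lemma coef_0 : coef 0 = 0.
Proof. unfold coef; simpl INR; rewrite pow_ne_zero, Rmult_0_l, Rinv_0; [easy | lia]. Qed.

Lemma coef_1 : coef 1 = / 3.
Proof. unfold coef, Binomial.C; simpl; field. Qed.

Lemma coef_S (k : nat) : (0 < k)%nat ->
  3 * (INR k + 1) * (3 * INR k + 1) * (3 * INR k + 2) * coef (S k) =
  2 * INR k ^ 2 * (2 * INR k + 1) * coef k.
Proof.
intros Hk; apply lt_0_INR in Hk; unfold coef.
generalize (binomial_3k_k_S k) (binomial_3k_k_pos k)
  (binomial_3k_k_pos (S k)).
rewrite S_INR; set (A := Binomial.C (3 * S k) _); set (B := Binomial.C _ _).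
intros E HB HA.
apply (Rmult_eq_reg_r (A * B)); [|nra].
transitivity (3 * (3 * INR k + 1) * (3 * INR k + 2) * B / (INR k + 1)).
- field; lra.
- rewrite <- E; field; lra.
Qed.

(** The ratio of consecutive coefficients is
[2 k^2 (2k+1) / (3 (k+1) (3k+1) (3k+2)) <= 4 / 27], so the terms of the series at
[27 / 4] decrease; [9 / 4] is the first of them. Their boundedness is all that
the radius of convergence needs. *)
Lemma coef_bound (k : nat) : coef (S k) * (27 / 4) ^ S k <= 9 / 4.
Proof.
induction k as [|k IH].
- rewrite coef_1; lra.
- refine (Rle_trans _ _ _ _ IH).
  assert (H := coef_S (S k) ltac:(lia)).
  assert (Hc := coef_S_pos k).
  assert (Hp : 0 < (27 / 4) ^ S k) by (apply pow_lt; lra).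
  assert (Hn : 0 < INR (S k)) by (apply lt_0_INR; lia).
  change ((27 / 4) ^ S (S k)) with (27 / 4 * (27 / 4) ^ S k).
  rewrite <- Rmult_assoc; apply Rmult_le_compat_r; [lra|].
  set (m := INR (S k)) in *; set (a := coef (S (S k))) in *; set (b := coef (S k)) in *.
  apply (Rmult_le_reg_l (3 * (m + 1) * (3 * m + 1) * (3 * m + 2))).
  { repeat apply Rmult_lt_0_compat; lra. }
  replace (3 * (m + 1) * (3 * m + 1) * (3 * m + 2) * (a * (27 / 4)))
    with (2 * m ^ 2 * (2 * m + 1) * (27 / 4) * b) by (rewrite <- (Rmult_assoc _ a), H; ring).
  apply Rmult_le_compat_r; [lra | nra].
Qed.

Lemma coef_CV_radius : Rbar_le (27 / 4) (CV_radius coef).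
Proof.
apply (proj1 (CV_radius_bounded coef)); exists (9 / 4); intros [|k].
- rewrite coef_0, Rmult_0_l, Rabs_R0; lra.
- rewrite Rabs_pos_eq; [apply coef_bound|].
  apply Rmult_le_pos; [apply Rlt_le, coef_S_pos | apply pow_le; lra].
Qed.

Definition F : R -> R := PSeries coef.
Definition F1 : R -> R := PSeries (PS_derive coef).
Definition F2 : R -> R := PSeries (PS_derive (PS_derive coef)).
Definition F3 : R -> R := PSeries (PS_derive (PS_derive (PS_derive coef))).

Lemma inside_disk (y : R) : Rabs y < 27 / 4 -> Rbar_lt (Rabs y) (CV_radius coef).
Proof. intros H; apply (Rbar_lt_le_trans _ (27 / 4)); [exact H | exact coef_CV_radius]. Qed.

Lemma is_derive_F (y : R) : Rabs y < 27 / 4 -> is_derive F y (F1 y).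
Proof. intros H; now apply is_derive_PSeries, inside_disk. Qed.

Lemma is_derive_F1 (y : R) : Rabs y < 27 / 4 -> is_derive F1 y (F2 y).
Proof.
intros H; apply is_derive_PSeries; rewrite CV_radius_derive; now apply inside_disk.
Qed.

Lemma is_derive_F2 (y : R) : Rabs y < 27 / 4 -> is_derive F2 y (F3 y).
Proof.
intros H; apply is_derive_PSeries; rewrite !CV_radius_derive; now apply inside_disk.
Qed.

(** The Euler operator [y d/dy] multiplies the coefficient of index [n] by [n]. It
turns recurrences with polynomial coefficients into differential equations. *)
Lemma is_pseries_theta (d : nat -> R) (y : R) :
  Rbar_lt (Rabs y) (CV_radius d) ->
  is_pseries (fun n => INR n * d n) y (y * PSeries (PS_derive d) y).
Proof.
intros H.
apply (is_pseries_ext (PS_incr_1 (PS_derive d))).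
- intros [|n]; [simpl; unfold zero; simpl; ring | reflexivity].
- apply (is_pseries_incr_1 (PS_derive d) y (PSeries (PS_derive d) y)).
  apply PSeries_correct, CV_radius_inside; now rewrite CV_radius_derive.
Qed.

(** With [d n = (n + 1) * coef (n + 1)] for the coefficients of [F'], the recurrence
reads [(27 n (n-1) + 54 n + 6) d n = (4 (n-1) (n-2) + 14 (n-1) + 6) d (n-1)] for
[n >= 1]. The two sides are the coefficients of index [n] of the [y]-free part of
the equation and of [y] times the rest; they differ only at [n = 0], by
[6 * d 0 = 2]. *)
Lemma F_ode (y : R) : Rabs y < 27 / 4 ->
  (27 - 4 * y) * y ^ 2 * F3 y + (54 - 14 * y) * y * F2 y + (6 - 6 * y) * F1 y = 2.
Proof.
intros Hy; apply inside_disk in Hy.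
set (d := PS_derive coef).
assert (Hd : Rbar_lt (Rabs y) (CV_radius d)) by (unfold d; now rewrite CV_radius_derive).
assert (H1 : is_pseries d y (F1 y)) by now apply PSeries_correct, CV_radius_inside.
assert (H2 : is_pseries (fun n => INR n * d n) y (y * F2 y))
  by now apply is_pseries_theta.
assert (H3 : is_pseries (fun n => INR n * (INR n - 1) * d n) y (y ^ 2 * F3 y)).
{ replace (y ^ 2 * F3 y) with (y * (y * F3 y)) by ring.
  apply (is_pseries_ext (PS_incr_1 (fun n => INR n * PS_derive d n))).
  - intros [|n]; [simpl; unfold zero; simpl; real_eq; ring|].
    unfold PS_incr_1, PS_derive; rewrite S_INR; real_eq; ring.
  - apply (is_pseries_incr_1 _ y (y * F3 y)).
    apply (is_pseries_theta (PS_derive d)); now rewrite CV_radius_derive. }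
(* A combination of [1], [n] and [n (n - 1)] as multiplier of the coefficients. *)
assert (comb : forall u v t, is_pseries
  (fun n => (u * (INR n * (INR n - 1)) + v * INR n + t) * d n) y
  (u * (y ^ 2 * F3 y) + v * (y * F2 y) + t * F1 y)).
{ intros u v t.
  apply (is_pseries_ext (PS_plus (PS_plus
     (PS_scal u (fun n => INR n * (INR n - 1) * d n))
     (PS_scal v (fun n => INR n * d n))) (PS_scal t d))).
  - intros n; unfold PS_plus, PS_scal, plus, scal; simpl; unfold mult; simpl; real_eq; ring.
  - assert (S : forall r e l, is_pseries e y l -> is_pseries (PS_scal r e) y (r * l))
      by (intros r e l He; apply (is_pseries_scal r e y l); [apply Rmult_comm | exact He]).
    exact (is_pseries_plus _ _ y _ _
      (is_pseries_plus _ _ y _ _ (S u _ _ H3) (S v _ _ H2)) (S t _ _ H1)). }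
assert (L := is_pseries_unique _ _ _ (comb 27 54 6)).
assert (M := is_pseries_unique _ _ _ (comb 4 14 6)).
(* Split off the term of index 0; the shifted series is then the one summed in [M]. *)
rewrite PSeries_decr_1 in L by (eexists; apply comb).
rewrite (PSeries_ext _ (fun n => (4 * (INR n * (INR n - 1)) + 14 * INR n + 6) * d n)) in L.
- rewrite M in L.
  replace (d 0%nat) with (/ 3) in L by (unfold d, PS_derive; rewrite coef_1; simpl; ring).
  simpl INR in L; lra.
- intros n; unfold PS_decr_1, d, PS_derive.
  assert (H := coef_S (S n) ltac:(lia)).
  generalize (pos_INR n); rewrite !S_INR in *; intros Hn.
  apply (Rmult_eq_reg_l (INR n + 1)); [|lra].
  transitivity ((INR n + 1) * (3 * (INR n + 1 + 1) * (3 * (INR n + 1) + 1) * (3 * (INR n + 1) + 2)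
    * coef (S (S n)))); [ring | rewrite H; ring].
Qed.

(** * The change of variable *)

(** Cardano: if [a ^ 3 = 1 + sqrt 2] then [u = a - 1 / a] satisfies
[u ^ 3 + 3 * u = a ^ 3 - 1 / a ^ 3 = 2]; here [c = 3 / 2 * u]. *)
Lemma c_cubic : 4 * c ^ 3 + 27 * c = 27.
Proof.
assert (H2 : sqrt 2 * sqrt 2 = 2) by (apply sqrt_sqrt; lra).
assert (Hs : 0 < sqrt 2) by (apply sqrt_lt_R0; lra).
unfold c; rewrite Rpower_Ropp.
set (a := Rpower (1 + sqrt 2) (1 / 3)).
assert (Ha : a ^ 3 = 1 + sqrt 2).
{ unfold a; rewrite <- Rpower_pow by apply exp_pos.
  rewrite Rpower_mult; replace (1 / 3 * INR 3) with 1 by (simpl; field).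
  apply Rpower_1; lra. }
assert (Ha0 : 0 < a) by apply exp_pos.
assert (Hi : (/ a) ^ 3 = sqrt 2 - 1).
{ rewrite pow_inv, Ha; apply (Rmult_eq_reg_l (1 + sqrt 2)); [|lra].
  rewrite Rinv_r by lra; lra. }
assert (Hai : a * / a = 1) by (apply Rinv_r; lra).
set (b := / a) in *.
replace (4 * (3 / 2 * (a - b)) ^ 3 + 27 * (3 / 2 * (a - b)))
  with (27 / 2 * (a ^ 3 - b ^ 3 - 3 * (a * b) * (a - b) + 3 * (a - b))) by field.
rewrite Ha, Hi, Hai; field.
Qed.

Lemma c_bounds : 0 < c < 1.
Proof. generalize c_cubic; intros; split; nra. Qed.

Definition ysub (x : R) : R := x ^ 3 / (x - 1).

(** The distances to the two ends of the disk factor: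
[27/4 - y = (2x-3)^2 (x+3) / (4 (1-x))], and
[27/4 + y = (27 - 27 x - 4 x^3) / (4 (1-x))] has the sign of [c - x]. *)
Lemma ysub_bound (x : R) : -3 < x < c -> Rabs (ysub x) < 27 / 4.
Proof.
intros Hx; assert (Hc := c_bounds); assert (Ec := c_cubic).
assert (H1 : 0 < / (1 - x)) by (apply Rinv_0_lt_compat; lra).
unfold ysub; apply Rabs_def1.
- apply Rlt_0_minus.
  replace (27 / 4 - x ^ 3 / (x - 1)) with ((2 * x - 3) ^ 2 * (x + 3) / 4 * / (1 - x))
    by (field; lra).
  apply Rmult_lt_0_compat; [|exact H1].
  assert (0 < (2 * x - 3) ^ 2) by nra; nra.
- apply Rlt_0_minus.
  replace (x ^ 3 / (x - 1) - - (27 / 4)) with ((27 - 27 * x - 4 * x ^ 3) / 4 * / (1 - x))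
    by (field; lra).
  apply Rmult_lt_0_compat; [|exact H1].
  assert (0 < (c - x) * (4 * (c ^ 2 + c * x + x ^ 2) + 27)); [|nra].
  apply Rmult_lt_0_compat; nra.
Qed.

Lemma is_derive_ysub (x : R) : x < 1 ->
  is_derive ysub x (x ^ 2 * (2 * x - 3) / (x - 1) ^ 2).
Proof. intros H; unfold ysub; auto_derive; [lra | field; lra]. Qed.

(** * The angle *)

(** For [x = 4 cos(h)^2 - 3] one has [1 - x = 4 sin(h)^2] and [3 + x = 4 cos(h)^2]. The
complex number whose argument defines [q x] becomes
[(sin (3h), cos (3h)) / (2 sin h)], by the triple-angle formulas. *)
Lemma q_double_angle (h : R) : 0 < h < PI / 2 ->
  q (4 * cos h ^ 2 - 3) = PI / 2 - 3 * h.
Proof.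
intros Hh.
assert (Hs : 0 < sin h) by (apply sin_gt_0; lra).
assert (Hc : 0 < cos h) by (apply cos_gt_0; lra).
assert (E : sin h ^ 2 + cos h ^ 2 = 1)
  by (rewrite <- !Rsqr_pow2; apply sin2_cos2).
rewrite q_rect by nra.
replace ((3 + (4 * cos h ^ 2 - 3)) / (1 - (4 * cos h ^ 2 - 3)))
  with ((cos h / sin h) ^ 2).
2:{ replace (1 - (4 * cos h ^ 2 - 3)) with (4 * sin h ^ 2) by lra; field; lra. }
rewrite sqrt_pow2 by (apply Rlt_le, Rdiv_lt_0_compat; lra).
rewrite <- (Arg_unique (/ (2 * sin h)) (PI / 2 - 3 * h)).
- rewrite cos_shift, sin_shift.
  replace (3 * h) with (2 * h + h) by ring.
  rewrite sin_plus, cos_plus, sin_2a, cos_2a_cos.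
  replace (2 * sin h * cos h * sin h) with (2 * (1 - cos h ^ 2) * cos h)
    by (rewrite <- E; ring).
  f_equal; f_equal; field; lra.
- apply Rinv_0_lt_compat; lra.
- lra.
Qed.

(** The angle [h] of [q_double_angle] is half of [acos ((1 + x) / 2)]. *)
Lemma q_acos (x : R) : -3 < x < 1 -> q x = PI / 2 - 3 / 2 * acos ((1 + x) / 2).
Proof.
intros Hx; set (h := acos ((1 + x) / 2) / 2).
assert (Hh : 0 < h < PI / 2).
{ destruct (acos_bound_lt ((1 + x) / 2)); unfold h; lra. }
replace (q x) with (q (4 * cos h ^ 2 - 3)).
- rewrite q_double_angle by exact Hh; unfold h; field.
- f_equal.
  assert (E : cos (2 * h) = (1 + x) / 2).
  { replace (2 * h) with (acos ((1 + x) / 2)) by (unfold h; field).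
    apply cos_acos; lra. }
  rewrite cos_2a_cos in E; lra.
Qed.

Lemma q_0 : q 0 = 0.
Proof.
rewrite q_acos by lra; replace ((1 + 0) / 2) with (cos (PI / 3)) by (rewrite cos_PI3; lra).
rewrite acos_cos; generalize PI_RGT_0; lra.
Qed.

Definition w (x : R) : R := sqrt ((1 - x) * (3 + x)).

Lemma w_pos (x : R) : -3 < x < 1 -> 0 < w x.
Proof. intros H; apply sqrt_lt_R0; nra. Qed.

Lemma w_sqr (x : R) : -3 < x < 1 -> w x ^ 2 = (1 - x) * (3 + x).
Proof. intros H; apply pow2_sqrt; nra. Qed.

Lemma is_derive_w (x : R) : -3 < x < 1 -> is_derive w x (- (1 + x) / w x).
Proof.
intros H; assert (Hw := w_pos x H); unfold w in *.
auto_derive; [nra | change (1 + - x) with (1 - x); field; lra].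
Qed.

Lemma is_derive_q (x : R) : -3 < x < 1 -> is_derive q x (3 / 2 / w x).
Proof.
intros Hx.
apply (is_derive_ext_loc (fun t => PI / 2 - 3 / 2 * acos ((1 + t) / 2))).
- apply (locally_interval _ x (-3) 1); simpl; try lra.
  intros t H1 H2; simpl in *; symmetry; apply q_acos; lra.
- assert (Hr : -1 < (1 + x) / 2 < 1) by lra.
  assert (H : is_derive acos ((1 + x) / 2) (-1 / sqrt (1 - ((1 + x) / 2)²))).
  { rewrite <- (derive_pt_acos _ Hr), Derive_Reals.
    apply Derive_correct, ex_derive_Reals_1, derivable_pt_acos, Hr. }
  assert (Hw := w_pos x Hx).
  replace (sqrt (1 - ((1 + x) / 2)²)) with (w x / 2) in H.
  2:{ unfold w; rewrite <- (sqrt_pow2 2) at 1 by lra.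
      rewrite <- sqrt_div_alt by lra; f_equal; unfold Rsqr; field. }
  auto_derive; [eexists; exact H|].
  match goal with |- context [Derive ?f ?u] => rewrite (is_derive_unique f u _ H) end.
  field; lra.
Qed.

(** * Integrating the equation *)

Lemma vanish_from_0 (phi : R -> R) (l r x : R) :
  l < 0 < r -> l < x < r -> phi 0 = 0 ->
  (forall t, l < t < r -> is_derive phi t 0) -> phi x = 0.
Proof.
intros H0 Hx E D; rewrite <- E.
destruct (Rtotal_order x 0) as [H | [-> | H]]; [|reflexivity | symmetry];
  apply eq_is_derive; intros; trivial; apply D; lra.
Qed.

(** This is [(1 - x)] times the derivative of [F (ysub x)]. *)
Definition g (x : R) : R := x ^ 2 * (2 * x - 3) / (1 - x) * F1 (ysub x).

(** The derivative of [g], spelled out so that it can be differentiated again. *)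
Definition g' (x : R) : R :=
  (- 4 * x ^ 3 + 9 * x ^ 2 - 6 * x) / (1 - x) ^ 2 * F1 (ysub x) +
  x ^ 4 * (2 * x - 3) ^ 2 / (1 - x) ^ 3 * F2 (ysub x).

Lemma is_derive_g (x : R) : -3 < x < c -> is_derive g x (g' x).
Proof.
intros Hx; assert (Hc := c_bounds).
assert (Hy := is_derive_ysub x ltac:(lra)).
assert (H1 := is_derive_F1 (ysub x) (ysub_bound x Hx)).
unfold g, g'; auto_derive.
- repeat split; try (eexists; eassumption); lra.
- derive_with H1; derive_with Hy; field; lra.
Qed.

(** With [s = (1 - x) / w], the derivative of [s] is [- 2 / ((3 + x) w)], and this is
the statement that [g' / s' = 2 q + 2 x / s]. It is the step that uses the
differential equation. *)
Lemma first_integral (x : R) : -3 < x < c ->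
  (3 + x) * w x / 2 * g' x + 2 * q x + 2 * x * w x / (1 - x) = 0.
Proof.
assert (Hc := c_bounds).
intros Hx.
apply (vanish_from_0 (fun x => (3 + x) * w x / 2 * g' x + 2 * q x + 2 * x * w x / (1 - x))
  (-3) c); [lra | lra | rewrite q_0; unfold g'; field |].
clear x Hx; intros x Hx.
assert (Hy := is_derive_ysub x ltac:(lra)).
assert (H1 := is_derive_F1 (ysub x) (ysub_bound x Hx)).
assert (H2 := is_derive_F2 (ysub x) (ysub_bound x Hx)).
assert (Hw := is_derive_w x ltac:(lra)).
assert (Hq := is_derive_q x ltac:(lra)).
assert (w0 := w_pos x ltac:(lra)).
assert (w2 := w_sqr x ltac:(lra)).
assert (ode := F_ode (ysub x) (ysub_bound x Hx)).
unfold g'.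
auto_derive.
- repeat split; try (eexists; eassumption);
    repeat apply Rmult_integral_contrapositive_currified; lra.
- derive_with H1; derive_with Hy; derive_with H2; derive_with Hw; derive_with Hq.
  set (A := F1 (ysub x)) in *; set (B := F2 (ysub x)) in *; set (D := F3 (ysub x)) in *.
  unfold ysub in ode.
  (* The multiplier is forced by comparing the coefficients of [D]. *)
  transitivity ((2 * x - 3) * (3 + x) / (2 * (1 - x) * w x) *
   ((27 - 4 * (x ^ 3 / (x - 1))) * (x ^ 3 / (x - 1)) ^ 2 * D +
      (54 - 14 * (x ^ 3 / (x - 1))) * (x ^ 3 / (x - 1)) * B +
      (6 - 6 * (x ^ 3 / (x - 1))) * A - 2)).
  2: rewrite ode; ring.
  field [w2]; repeat split; lra.
Qed.

(** Since [w / (3 + x) = (1 - x) / w = s], the right-hand side has derivative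
[2 q s' + 3 s / w - 1 / (1 - x)], the last two terms of which add up to [2 x s' / s];
this is [g'] by [first_integral]. *)
Lemma g_closed_form (x : R) : -3 < x < c ->
  g x = 2 * q x * w x / (3 + x) + ln (1 - x).
Proof.
assert (Hc := c_bounds).
intros Hx; apply Rminus_diag_uniq.
apply (vanish_from_0 (fun x => g x - (2 * q x * w x / (3 + x) + ln (1 - x))) (-3) c);
 [lra | lra | |].
- rewrite q_0, Rminus_0_r, ln_1; unfold g; field.
- clear x Hx; intros x Hx.
  assert (Hg := is_derive_g x Hx).
  assert (Hw := is_derive_w x ltac:(lra)).
  assert (Hq := is_derive_q x ltac:(lra)).
  assert (w0 := w_pos x ltac:(lra)).
  assert (w2 := w_sqr x ltac:(lra)).
  assert (fi := first_integral x Hx).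
  auto_derive.
  + repeat split; try (eexists; eassumption); lra.
  + derive_with Hg; derive_with Hw; derive_with Hq.
    transitivity (2 / ((3 + x) * w x) *
      ((3 + x) * w x / 2 * g' x + 2 * q x + 2 * x * w x / (1 - x)));
      [|rewrite fi; ring].
    field [w2]; repeat split; lra.
Qed.

(** The derivative of the right-hand side is
[2 q / w + ln (1 - x) / (1 - x)], which is [g x / (1 - x)] by [g_closed_form]. *)
Lemma F_closed_form (x : R) : -3 < x < c ->
  F (ysub x) = 2 / 3 * q x ^ 2 - 1 / 2 * ln (1 - x) ^ 2.
Proof.
assert (Hc := c_bounds).
intros Hx; apply Rminus_diag_uniq.
apply (vanish_from_0
  (fun x => F (ysub x) - (2 / 3 * q x ^ 2 - 1 / 2 * ln (1 - x) ^ 2)) (-3) c);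
 [lra | lra | |].
- replace (ysub 0) with 0 by (unfold ysub; field).
  unfold F; rewrite PSeries_0, coef_0, q_0, Rminus_0_r, ln_1; field.
- clear x Hx; intros x Hx.
  assert (Hy := is_derive_ysub x ltac:(lra)).
  assert (HF := is_derive_F (ysub x) (ysub_bound x Hx)).
  assert (Hq := is_derive_q x ltac:(lra)).
  assert (w0 := w_pos x ltac:(lra)).
  assert (w2 := w_sqr x ltac:(lra)).
  assert (cf := g_closed_form x Hx).
  auto_derive.
  + repeat split; try (eexists; eassumption); lra.
  + derive_with HF; derive_with Hy; derive_with Hq.
    transitivity ((g x - (2 * q x * w x / (3 + x) + ln (1 - x))) / (1 - x));
      [|rewrite cf; field; lra].
    replace (2 * q x * w x / (3 + x)) with (2 * q x * (1 - x) / w x).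
    * unfold g; change (1 + - x) with (1 - x); field; lra.
    * apply (Rmult_eq_reg_r (w x * (3 + x))); [|nra].
      transitivity (2 * q x * w x ^ 2); [rewrite w2|]; field; lra.
Qed.

Theorem theorem1p2 (x : R) (hx : -3 < x < c) :
  is_series
    (fun n : nat =>
       let k := S n in
       x ^ (3 * k) / (INR k ^ 2 * (x - 1) ^ k * Binomial.C (3 * k) k))
    (2 / 3 * q x ^ 2 - 1 / 2 * ln (1 - x) ^ 2).
Proof.
rewrite <- (F_closed_form x hx).
assert (Hc := c_bounds).
apply (is_series_ext (fun n => coef (S n) * ysub x ^ S n)).
- intros n; cbv zeta; unfold coef, ysub.
  unfold Rdiv at 1; rewrite Rpow_mult_distr, pow_inv, <- pow_mult.
  assert (Hb := binomial_3k_k_pos (S n)).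
  assert (Hn : 0 < INR (S n)) by (apply lt_0_INR; lia).
  assert (Hp : (x - 1) ^ S n <> 0) by (apply pow_nonzero; lra).
  real_eq; field; repeat split; lra.
- apply (is_series_ext (fun n => scal (pow_n (ysub x) (S n)) (coef (S n)))).
  + intros n; rewrite pow_n_pow; apply Rmult_comm.
  + apply (is_series_incr_1 (fun n => scal (pow_n (ysub x) n) (coef n))).
    replace (plus _ _) with (F (ysub x)).
    * apply PSeries_correct, CV_radius_inside, inside_disk, ysub_bound, hx.
    * rewrite coef_0; unfold plus, scal; simpl; unfold mult; simpl; ring.
Qed.
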